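(* Let $R$ be a ring. Then $R$ is both 2-UQ and clean if and only if $R$ is semi-tripotent.
   Context: Rings are associative with unity, not necessarily commutative. $J(R)$ is the Jacobson radical and $U(R)$ the set of units. An element $a\in R$ is quasi-nilpotent if $1-ax$ is invertible for every $x\in R$ with $ax=xa$; $QN(R)$ is the set of quasi-nilpotent elements. $R$ is 2-UQ if the square of each unit is the sum of an idempotent and a quasi-nilpotent element that commute with each other; equivalently, for each $u\in U(R)$, $u^2=1+q$ with $q\in QN(R)$. $R$ is clean if each of its elements is the sum of an idempotent and a unit. An element $e$ is tripotent if $e^3=e$, and a ring is tripotent if all its elements are. An element of $R$ is semi-tripotent if it is the sum of a tripotent element of $R$ and an element of $J(R)$; $R$ is semi-tripotent if every element of $R$ is semi-tripotent, which is equivalent to $R/J(R)$ being tripotent and idempotents lifting modulo $J(R)$. *)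

(* Defs.v *)
From HB Require Import structures.
From mathcomp Require Import all_boot all_algebra.

Set Implicit Arguments.
Unset Strict Implicit.
Unset Printing Implicit Defensive.

Import GRing.Theory.
Local Open Scope ring_scope.

(* Rings are [pzRingType]: unital, not necessarily commutative, the zero ring
   allowed.  GRing.unit needs a decidable, nontrivial [unitRingType], so
   invertibility is stated here by a two-sided inverse. *)
Definition invertible (R : pzRingType) (x : R) : Prop :=
  exists y : R, x * y = 1 /\ y * x = 1.

Definition idempotent_elt (R : pzRingType) (e : R) : Prop := e * e = e.

Definition tripotent_elt (R : pzRingType) (e : R) : Prop := e ^+ 3 = e.

Definition left_ideal (R : pzRingType) (I : R -> Prop) : Prop :=
  [/\ I 0,
      forall x y : R, I x -> I y -> I (x - y)
    & forall a x : R, I x -> I (a * x)].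

Definition maximal_left_ideal (R : pzRingType) (M : R -> Prop) : Prop :=
  [/\ left_ideal M,
      ~ M 1
    & forall I : R -> Prop, left_ideal I -> (forall x : R, M x -> I x) ->
        ~ I 1 -> forall x : R, I x -> M x].

(* J(R) *)
Definition jacobson (R : pzRingType) (x : R) : Prop :=
  forall M : R -> Prop, maximal_left_ideal M -> M x.

Definition quasi_nilpotent (R : pzRingType) (a : R) : Prop :=
  forall x : R, a * x = x * a -> invertible (1 - a * x).

Definition two_UQ (R : pzRingType) : Prop :=
  forall u : R, invertible u ->
    exists e q : R, [/\ idempotent_elt e, quasi_nilpotent q,
                        e * q = q * e & u ^+ 2 = e + q].

Definition clean (R : pzRingType) : Prop :=
  forall a : R, exists e u : R,
    [/\ idempotent_elt e, invertible u & a = e + u].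

Definition semi_tripotent_elt (R : pzRingType) (a : R) : Prop :=
  exists e j : R, [/\ tripotent_elt e, jacobson j & a = e + j].

Definition semi_tripotent (R : pzRingType) : Prop :=
  forall a : R, semi_tripotent_elt a.

(* Main.v *)
(** Write [J] for the Jacobson radical.  If [R] is clean, every [x] outside [J]
    has a nonzero idempotent multiple [e = r x].  Suppose [R] is also 2-UQ, so
    that [u^2 - 1] is quasi-nilpotent for every unit [u].

    - [R/J] is reduced: if [x^2] is in [J] but [x] is not, then [e] is the first
      diagonal element of a system of 2x2 matrix units, and the unit of [R]
      acting as [[1, 1], [1, 0]] on it satisfies [u^2 - 1 = [[1, 1], [1, 0]]],
      which is invertible in a nonzero corner.  Hence idempotents are central
      modulo [J].
    - [u^2 - 1] is in [J] for every unit [u]: otherwise [e = r (u^2 - 1)] gives a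
      unit [e u e + 1 - e] whose square minus 1 is invertible in [e R e].
    - Writing [3 = e + u] yields [6] in [J], hence [3 (u - 1)] in [J] for every
      unit [u], and then [a = e + u] gives [a^3 - a] and [3 (a^2 - a)] in [J].
    - Then [2 a - a^2] and [a - a^2] are orthogonal idempotents modulo [J] with
      difference [a]; their orthogonal lifts differ by a tripotent lift of [a].

    Conversely, a tripotent [e] is the sum of the idempotent [1 - e^2] and the
    involution [e^2 + e - 1], and a tripotent unit is an involution. *)

Require Import Defs.
From mathcomp Require Import all_boot all_algebra.
From mathcomp Require Import boolp classical_sets.
From Stdlib Require Ncring Ncring_tac.

Set Implicit Arguments.
Unset Strict Implicit.
Unset Printing Implicit Defensive.

Import GRing.Theory.
Local Open Scope ring_scope.

(** * Normalisation of noncommutative ring identities *)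

Section NoncommutativeRing.
Variable R : pzRingType.

#[local] Instance pzRing_ops :
  @Ncring.Ring_ops R 0 1 +%R *%R (fun x y => x - y) -%R eq := {}.

#[local] Instance pzRing_ring : Ncring.Ring (Ro := pzRing_ops).
Proof.
split; try exact: _.
- by move=> x; exact: add0r.
- by move=> x y; exact: addrC.
- by move=> x y z; exact: addrA.
- by move=> x; exact: mul1r.
- by move=> x; exact: mulr1.
- by move=> x y z; exact: mulrA.
- by move=> x y z; exact: mulrDl.
- by move=> x y z; exact: mulrDr.
- by move=> x; exact: subrr.
Qed.

End NoncommutativeRing.

#[local] Existing Instance pzRing_ops.
#[local] Existing Instance pzRing_ring.

Ltac nc_ring :=
  rewrite ?(exprS, expr0, mulrS, mulr0n); Ncring_tac.non_commutative_ring.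

(** * The Jacobson radical: quasi-regularity, units and idempotents *)

Section Jacobson.
Variable R : pzRingType.
Implicit Types (x y z r e u : R).

Lemma subset_maximal_left_ideal y :
  (forall s, s * y <> 1) -> exists2 M, maximal_left_ideal M & M y.
Proof.
move=> yN1.
pose good (A : set R) := [/\ left_ideal A, A y & ~ A 1].
have [F FP Ftot|A [PA maxA]] := @Zorn_bigcup R (fun A => A = set0 \/ good A).
  have [[X FX goodX]|Fno] := pselect (exists2 X, F X & good X); last first.
    left; apply/seteqP; split=> // x [X FX Xx].
    by have [X0|gX] := FP _ FX; [rewrite X0 in Xx|apply: Fno; exists X].
  right; split; first split.
  - by exists X => //; case: goodX => -[].
  - move=> a b [A FA Aa] [B FB Bb].
    have [A0|[[_ subA _] _ _]] := FP _ FA; first by rewrite A0 in Aa.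
    have [B0|[[_ subB _] _ _]] := FP _ FB; first by rewrite B0 in Bb.
    have [AB|BA] := Ftot _ _ FA FB.
      by exists B => //; apply: subB => //; apply: AB.
    by exists A => //; apply: subA => //; apply: BA.
  - move=> a b [B FB Bb].
    have [B0|[[_ _ mulB] _ _]] := FP _ FB; first by rewrite B0 in Bb.
    by exists B => //; apply: mulB.
  - by exists X => //; case: goodX.
  - case=> B FB B1.
    by have [B0|[]] := FP _ FB; [rewrite B0 in B1|].
have good_Ry : good (fun x => exists s, x = s * y).
  split; first split.
  - by exists 0; rewrite mul0r.
  - by move=> _ _ [s ->] [t ->]; exists (s - t); rewrite mulrBl.
  - by move=> a _ [s ->]; exists (a * s); rewrite mulrA.
  - by exists 1; rewrite mul1r.
  - by case=> s /esym; apply: yN1.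
case: PA => [A0|[idA Ay AN1]].
  have := maxA _ _ (or_intror good_Ry); case; rewrite A0.
  by split=> // /(_ y); apply; exists 1; rewrite mul1r.
exists A => //; split=> // I idI AI IN1 x Ix; apply: contrapT => NAx.
apply: (maxA I); first by split=> // /(_ x Ix).
by right; split=> //; apply: AI.
Qed.

(** If [1 - r * x] has no left inverse, it lies in a maximal left ideal, which cannot contain [x].
    Conversely, if [x] is outside [M], then [M + R x] contains 1, so some [1 - r * x] is in [M]. *)
Lemma jacobsonP x : jacobson x <-> forall r, exists s, s * (1 - r * x) = 1.
Proof.
split=> [Jx r|linv M maxM].
  apply: contrapT => noinv.
  have [s sy1|M maxM My] := @subset_maximal_left_ideal (1 - r * x).
    by apply: noinv; exists s.
  have [[M0 subM mulM] MN1 _] := maxM; apply: MN1.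
  have -> : 1 = (1 - r * x) - (0 - r * x) by nc_ring.
  exact: (subM _ _ My (subM _ _ M0 (mulM r x (Jx M maxM)))).
have [[M0 subM mulM] MN1 max] := maxM; apply: contrapT => NMx.
pose I z := exists m r, M m /\ z = m + r * x.
have idI : left_ideal I.
  split; first by exists 0, 0; split=> //; nc_ring.
    move=> _ _ [m [r [Mm ->]]] [n [s [Mn ->]]].
    by exists (m - n), (r - s); split; [apply: subM|nc_ring].
  move=> a _ [m [r [Mm ->]]].
  by exists (a * m), (a * r); split; [apply: mulM|nc_ring].
apply/NMx/(max I) => //; last by exists 0, 1; split=> //; nc_ring.
  by move=> m Mm; exists m, 0; split=> //; nc_ring.
case=> m [r [Mm eq1]]; have [s s1] := linv r; apply: MN1; rewrite -s1.
by apply: mulM; rewrite (_ : 1 - r * x = m) // eq1; nc_ring.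
Qed.

Lemma jacobson0 : jacobson (0 : R).
Proof. by move=> M [[]]. Qed.

Lemma jacobsonB x y : jacobson x -> jacobson y -> jacobson (x - y).
Proof.
move=> Jx Jy M maxM; have [[_ subM _] _ _] := maxM.
by apply: subM; [apply: Jx|apply: Jy].
Qed.

Lemma jacobsonN x : jacobson x -> jacobson (- x).
Proof. by move=> Jx; rewrite -sub0r; exact: (jacobsonB jacobson0 Jx). Qed.

Lemma jacobsonD x y : jacobson x -> jacobson y -> jacobson (x + y).
Proof. by move=> Jx Jy; rewrite -[y]opprK; exact: (jacobsonB Jx (jacobsonN Jy)). Qed.

Lemma jacobsonMl r x : jacobson x -> jacobson (r * x).
Proof.
by move=> Jx M maxM; have [[_ _ mulM] _ _] := maxM; apply: mulM; exact: Jx.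
Qed.

Lemma jacobsonMr r x : jacobson x -> jacobson (x * r).
Proof.
move=> /jacobsonP Jx; apply/jacobsonP => s; have [t ht] := Jx (r * s).
(* If [t] is a left inverse of [1 - a b], then [1 + b t a] is one of [1 - b a]; here [a = r] and
   [b = s * x]. *)
exists (1 + s * x * t * r).
have -> : (1 + s * x * t * r) * (1 - s * (x * r)) =
  1 - s * x * r + s * x * (t * (1 - r * s * x)) * r by nc_ring.
by rewrite ht; nc_ring.
Qed.

(** A left inverse [s] of [1 - x] equals [1 + s * x], so it is left invertible too, hence
    two-sided. *)
Lemma invertible1B_jacobson x : jacobson x -> invertible (1 - x).
Proof.
move=> /jacobsonP Jx.
have [s] := Jx 1; rewrite mul1r => s1.
have [t] := Jx (- s).
have -> : 1 - - s * x = s by rewrite -{1}s1; nc_ring.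
move=> t1; have ts : t = 1 - x.
  by rewrite -[LHS]mulr1 -[in LHS]s1 mulrA t1 mul1r.
by exists s; rewrite -{1}ts.
Qed.


Lemma invertible_mod_jacobson x y :
  jacobson (x * y - 1) -> jacobson (y * x - 1) -> invertible x.
Proof.
move=> /jacobsonN/invertible1B_jacobson[s [s1 _]].
move=> /jacobsonN/invertible1B_jacobson[t [_ t1]].
have xr : x * (y * s) = 1 by rewrite -s1; nc_ring.
have xl : t * y * x = 1 by rewrite -t1; nc_ring.
exists (y * s); split=> //.
by rewrite -[y * s]mul1r -{1}xl -(mulrA _ x) xr mulr1.
Qed.

Lemma idempotent_elt1B e : idempotent_elt e -> idempotent_elt (1 - e).
Proof.
move=> ee; rewrite /idempotent_elt.
have -> : (1 - e) * (1 - e) = 1 - e + (e * e - e) by nc_ring.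
by rewrite ee; nc_ring.
Qed.

Lemma idempotent1B_invertible e :
  idempotent_elt e -> invertible (1 - e) -> e = 0.
Proof.
move=> ee [s [s1 _]].
rewrite -[e]mulr1 -s1 (_ : e * ((1 - e) * s) = (e - e * e) * s); last by nc_ring.
by rewrite ee; nc_ring.
Qed.

Lemma idempotent_jacobson e : idempotent_elt e -> jacobson e -> e = 0.
Proof. by move=> ee /invertible1B_jacobson; apply: idempotent1B_invertible. Qed.

Lemma jacobson_quasi_nilpotent x : jacobson x -> quasi_nilpotent x.
Proof. by move=> Jx r _; apply: invertible1B_jacobson; apply: jacobsonMr. Qed.

Lemma quasi_nilpotent_idempotent q z :
  quasi_nilpotent q -> q * z = z * q -> idempotent_elt (q * z) -> q * z = 0.
Proof. by move=> qn /qn; move=> inv1B idem; apply: idempotent1B_invertible. Qed.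

(** Since [x * e = x], multiplying [v * (1 - e + y * x) = 1] by [e] on the right leaves
    [v * y * x = e]. *)
Lemma left_inverse_mod_jacobson e x y :
  idempotent_elt e -> x * e = x -> jacobson (e - y * x) ->
  exists v, v * y * x = e.
Proof.
move=> ee xe /invertible1B_jacobson[v [_ v1]]; exists v.
have -> : v * y * x = v * (1 - (e - y * x)) * e + v * y * (x - x * e)
  - v * (e - e * e) by nc_ring.
by rewrite v1 xe ee; nc_ring.
Qed.

End Jacobson.

(** * Idempotents in clean rings *)

Section Clean.
Variable R : pzRingType.
Hypothesis cleanR : clean R.
Implicit Types (a x y z r e u : R).

(* Nicholson's identity: if [a = e + u] then [u^-1 (1 - e) u] is an idempotent
   which differs from [a] by [u^-1 (a^2 - a)]. *)
Lemma clean_idempotent a :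
  exists f s, idempotent_elt f /\ f = a - s * (a * a - a).
Proof.
have [e [u [ee [s [us su]] ->]]] := cleanR a.
exists (s * (1 - e) * u), s; split.
  rewrite /idempotent_elt.
  have -> : s * (1 - e) * u * (s * (1 - e) * u) =
            s * (1 - e) * (u * s) * (1 - e) * u by nc_ring.
  by rewrite us mulr1 -(mulrA s) (idempotent_elt1B ee).
have -> : s * (1 - e) * u = e + u - s * ((e + u) * (e + u) - (e + u))
   + s * (e * e - e) + (s * u - 1) * e + (s * u - 1) * u by nc_ring.
by rewrite ee su; nc_ring.
Qed.

Lemma clean_lift_idempotent a : jacobson (a * a - a) ->
  exists2 f, idempotent_elt f & jacobson (a - f).
Proof.
move=> Ja; have [f [s [ff fE]]] := clean_idempotent a.
exists f => //; rewrite fE (_ : a - _ = s * (a * a - a)); last by nc_ring.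
exact: jacobsonMl.
Qed.

(** [clean_idempotent] at [r * x] yields a left multiple of [x]; if it is 0, then [1 - s * (r * x)]
    is a left inverse of [1 - r * x]. *)
Lemma clean_idempotent_multiple x : ~ jacobson x ->
  exists2 r, idempotent_elt (r * x) & r * x <> 0.
Proof.
move=> NJx; apply: contrapT => noidem; apply/NJx/jacobsonP => r.
have [f [s [ff fE]]] := clean_idempotent (r * x).
have [f0|fN0] := pselect (f = 0).
  exists (1 - s * (r * x)); apply/subr0_eq.
  have -> : (1 - s * (r * x)) * (1 - r * x) - 1 =
    - (r * x - s * (r * x * (r * x) - r * x)) by nc_ring.
  by rewrite -fE f0 oppr0.
case: noidem; exists ((1 - s * (r * x - 1)) * r).
  by rewrite (_ : _ * x = f) // fE; nc_ring.
by rewrite (_ : _ * x = f) // fE; nc_ring.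
Qed.

End Clean.

(** Expands to left-associated monomials, on which relations between generators act as rewriting
    rules. *)
Definition expandE := (mulrDl, mulrDr, mulrN, mulNr, mulrA, opprD, @opprK).

(** * Units of 2-UQ rings, then clean 2-UQ rings modulo J *)

Section TwoUQ.
Variable R : pzRingType.
Hypothesis UQ : two_UQ R.
Implicit Types (a x y z r e u : R).

(** Here [e = u^2 (1 - q u^-2)] is a unit, as [q] commutes with [u^-2]; an invertible idempotent is
    1. *)
Lemma invertible_sqr_quasi_nilpotent u :
  invertible u -> quasi_nilpotent (u * u - 1).
Proof.
move=> uinv; have [e [q [ee qn eq]]] := UQ uinv; rewrite expr2 => uuE.
have [s [us su]] := uinv.
have quu : q * (u * u) = u * u * q by rewrite uuE mulrDl mulrDr eq.
have uuss : u * u * (s * s) = 1.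
  by rewrite mulrA -(mulrA u u s) us mulr1 us.
have ssuu : s * s * (u * u) = 1.
  by rewrite mulrA -(mulrA s s u) su mulr1 su.
have qss : q * (s * s) = s * s * q.
  rewrite -[LHS]mul1r -ssuu -[RHS]mulr1 -uuss.
  have -> : s * s * (u * u) * (q * (s * s)) =
    s * s * (u * u * q) * (s * s) by nc_ring.
  by rewrite -quu !mulrA.
have [t [t1 t2]] := qn _ qss.
suff e1 : e = 1 by rewrite uuE e1 addrAC subrr add0r.
have eE : e = u * u * (1 - q * (s * s)).
  rewrite qss.
  have -> : u * u * (1 - s * s * q) = u * u - u * u * (s * s) * q by nc_ring.
  by rewrite uuss uuE; nc_ring.
have einv : e * (t * (s * s)) = 1.
  by rewrite eE -mulrA (mulrA _ t) t1 mul1r.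
by rewrite -[e]mulr1 -{1}einv mulrA ee.
Qed.

(* [e], [y], [x], [x * y] are the matrix units e11, e12, e21, e22. *)
Lemma two_UQ_matrix_units e x y : idempotent_elt e ->
  e * x = 0 -> x * e = x -> e * y = y -> y * e = 0 -> y * x = e -> e = 0.
Proof.
move=> ee ex xe ey ye yx.
have xx : x * x = 0 by rewrite -{1}xe -mulrA ex mulr0.
have yy : y * y = 0 by rewrite -{2}ey mulrA ye mul0r.
have tee t : t * e * e = t * e by rewrite -mulrA ee.
have tex t : t * e * x = 0 by rewrite -mulrA ex mulr0.
have txe t : t * x * e = t * x by rewrite -mulrA xe.
have tey t : t * e * y = t * y by rewrite -mulrA ey.
have tye t : t * y * e = 0 by rewrite -mulrA ye mulr0.
have tyx t : t * y * x = t * e by rewrite -mulrA yx.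
have txx t : t * x * x = 0 by rewrite -mulrA xx mulr0.
have tyy t : t * y * y = 0 by rewrite -mulrA yy mulr0.
pose rules := (ee, ex, xe, ey, ye, yx, xx, yy, tee, tex, txe, tey, tye, tyx,
  txx, tyy, mul0r, mulr0, mul1r, mulr1).
pose w := 1 - x * y + x + y.
pose m := e + x + y.
(* [z] is [[0, 1], [1, -1]], the inverse of [m] in the corner of [e + x * y]. *)
pose z := x + y - x * y.
have winv : invertible w.
  exists (1 - e - x * y + z); rewrite /w /z.
  by split; rewrite !expandE; do !rewrite !rules; nc_ring.
have mE : w * w - 1 = m.
  by rewrite /w /m; rewrite !expandE; do !rewrite !rules; nc_ring.
have mz : m * z = e + x * y.
  by rewrite /z /m; rewrite !expandE; do !rewrite !rules; nc_ring.
have zm : z * m = e + x * y.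
  by rewrite /z /m; rewrite !expandE; do !rewrite !rules; nc_ring.
have mqn : quasi_nilpotent m.
  by rewrite -mE; apply: invertible_sqr_quasi_nilpotent.
have exy0 : e + x * y = 0.
  rewrite -mz; apply: quasi_nilpotent_idempotent => //; first by rewrite mz zm.
  by rewrite /idempotent_elt mz !expandE; do !rewrite !rules; nc_ring.
by move: (congr1 ( *%R e) exy0); rewrite mulrDr mulrA ee ex mul0r addr0 mulr0.
Qed.

Hypothesis cleanR : clean R.

Lemma jacobson_sqr x : jacobson (x * x) -> jacobson x.
Proof.
move=> Jxx; apply: contrapT => /(clean_idempotent_multiple cleanR)[r].
move: {-1}(r * x) (erefl (r * x)) => e eE ee; apply.
have ex : e * x = r * (x * x) by rewrite -eE mulrA.
(* As [e * x] is in J, [y * x'] is [e] modulo J; the factor [v] below makes this exact. *)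
pose x' := (1 - e) * x * e; pose y := e * r * (1 - e).
have x'e : x' * e = x' by rewrite /x' -!mulrA ee.
have [|v vyx] := @left_inverse_mod_jacobson _ e x' y ee x'e.
  have -> : e - y * x' = e - e * (r * x) * e + e * r * (e * x) * e
    - e * r * (e * e - e) * x * e by rewrite /x' /y; nc_ring.
  rewrite eE ex !ee subrr add0r mulr0 !mul0r subr0.
  by apply: jacobsonMr; do 2!apply: jacobsonMl.
apply: (@two_UQ_matrix_units e x' (e * v * y)) => //.
- have -> : e * x' = (e - e * e) * x * e by rewrite /x'; nc_ring.
  by rewrite ee; nc_ring.
- by rewrite !mulrA ee.
- have -> : e * v * y * e = e * v * e * r * (e - e * e) by rewrite /y; nc_ring.
  by rewrite ee; nc_ring.
- by rewrite -(mulrA e v y) -(mulrA e) vyx.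
Qed.

(** The two off-diagonal Peirce components of [r] square to 0. *)
Lemma idempotent_central_mod_jacobson e r :
  idempotent_elt e -> jacobson (e * r - r * e).
Proof.
move=> ee.
have -> : e * r - r * e = e * r * (1 - e) - (1 - e) * r * e by nc_ring.
apply: jacobsonB; apply: jacobson_sqr.
- have -> : e * r * (1 - e) * (e * r * (1 - e)) =
    e * r * (e - e * e) * r * (1 - e) by nc_ring.
  by rewrite ee subrr mulr0 !mul0r; exact: jacobson0.
- have -> : (1 - e) * r * e * ((1 - e) * r * e) =
    (1 - e) * r * (e - e * e) * r * e by nc_ring.
  by rewrite ee subrr mulr0 !mul0r; exact: jacobson0.
Qed.

(** The idempotent [e - p * t] equals its commutator with [t] times [p], so it lies in J and
    vanishes. *)
Lemma idempotent_corner_inverse e p t : idempotent_elt e ->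
  e * p = p -> p * e = p -> t * e = t -> t * p = e -> p * t = e.
Proof.
move=> ee ep pe te tp.
have hh : idempotent_elt (e - p * t).
  rewrite /idempotent_elt.
  have -> : (e - p * t) * (e - p * t) =
    e * e - e * p * t - p * (t * e) + p * (t * p) * t by nc_ring.
  by rewrite ee ep te tp pe; nc_ring.
apply/esym/subr0_eq/idempotent_jacobson => //.
have -> : e - p * t = ((e - p * t) * t - t * (e - p * t)) * p.
  have tpl z : z * t * p = z * e by rewrite -mulrA tp.
  by rewrite !expandE; do !rewrite ?(ee, te, tp, tpl); rewrite -mulrA te; nc_ring.
by apply: jacobsonMr; apply: idempotent_central_mod_jacobson.
Qed.

Lemma invertible_sqr_mod_jacobson u : invertible u -> jacobson (u * u - 1).
Proof.
move=> uinv; apply: contrapT => /(clean_idempotent_multiple cleanR)[r].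
move: {-1}(r * _) (erefl (r * (u * u - 1))) => e eE ee; apply.
have Jc x : jacobson (e * x - x * e) by apply: idempotent_central_mod_jacobson.
have [u' [uu' u'u]] := uinv.
have eel z : z * e * e = z * e by rewrite -mulrA ee.
have uu'l z : z * u * u' = z by rewrite -mulrA uu' mulr1.
have u'ul z : z * u' * u = z by rewrite -mulrA u'u mulr1.
pose w := e * u * e + 1 - e; pose p := e * u * e * u * e - e.
pose rules := (ee, eel, uu'l, u'ul, mulr1, mul1r).
have wwE : w * w - 1 = p.
  by rewrite /w /p !expandE; do !rewrite !rules; nc_ring.
have winv : invertible w.
  apply: (@invertible_mod_jacobson _ w (e * u' * e + 1 - e)).
    have -> : w * (e * u' * e + 1 - e) - 1 = e * u * (e * u' - u' * e) * e.
      by rewrite /w !expandE; do !rewrite !rules; nc_ring.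
    by apply: jacobsonMr; apply: jacobsonMl.
  have -> : (e * u' * e + 1 - e) * w - 1 = e * u' * (e * u - u * e) * e.
    by rewrite /w !expandE; do !rewrite !rules; nc_ring.
  by apply: jacobsonMr; apply: jacobsonMl.
have ep : e * p = p by rewrite /p !expandE; do !rewrite !rules.
have pe : p * e = p by rewrite /p !expandE; do !rewrite !rules.
(* Modulo J, [e] is central, so [e * r * e] is a left inverse of [p] in the corner of [e]. *)
have [|v vtp] := @left_inverse_mod_jacobson _ e p (e * r * e) ee pe.
  have eE' : e = e * r * u * u * e - e * r * e.
    have <- : e * (r * (u * u - 1)) * e = e * r * u * u * e - e * r * e by nc_ring.
    by rewrite eE !ee.
  have -> : e - e * r * e * p =
    - (e * r * (e * u * (e * u - u * e) + (e * (u * u) - u * u * e)) * e).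
    by rewrite {1}eE' /p !expandE; do !rewrite !rules; nc_ring.
  apply: jacobsonN; apply: jacobsonMr; apply: jacobsonMl.
  by apply: jacobsonD => //; apply: jacobsonMl.
have tp : e * v * (e * r * e) * p = e.
  by rewrite -(mulrA e v) -(mulrA e (v * _)) vtp.
have pt : p * (e * v * (e * r * e)) = e.
  by apply: idempotent_corner_inverse => //; rewrite !expandE !rules.
rewrite -pt; apply: quasi_nilpotent_idempotent; last by rewrite pt.
  by rewrite -wwE; apply: invertible_sqr_quasi_nilpotent.
by rewrite pt tp.
Qed.

Lemma six_mod_jacobson : jacobson (6%:R : R).
Proof.
have J24 : jacobson (24%:R : R).
  have [e [u [ee uinv e3]]] := cleanR 3%:R.
  have Ju := invertible_sqr_mod_jacobson uinv.
  have uE : u = 3%:R - e by rewrite e3; nc_ring.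
  have J3e : jacobson (e * (u * u - 1)) by apply: jacobsonMl.
  (* [u^2 - 1 = 8 - 5 e] and [e (u^2 - 1) = 3 e]; the coefficients 3 and 5 eliminate [e]. *)
  have -> : (24%:R : R) = 3%:R * (u * u - 1) + 5%:R * (e * (u * u - 1)) .
    rewrite uE.
    have -> : (24%:R : R) = 3%:R * ((3%:R - e) * (3%:R - e) - 1)
      + 5%:R * (e * ((3%:R - e) * (3%:R - e) - 1)) - 5%:R * (e * e - e) * e
      + 22%:R * (e * e - e) by nc_ring.
    by rewrite ee subrr mulr0 mul0r subr0 mulr0 addr0.
  by apply: jacobsonD; apply: jacobsonMl.
apply: jacobson_sqr; apply: jacobson_sqr.
have -> : (6%:R * 6%:R * (6%:R * 6%:R) : R) = 54%:R * 24%:R by rewrite -!natrM.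
exact: jacobsonMl.
Qed.

(** Modulo J, [u^2 = 1] and [18 = 0], so the square is [18 (1 - u) = 0]. *)
Lemma invertible_sub1_mul3_jacobson u : invertible u -> jacobson (3%:R * (u - 1)).
Proof.
move=> uinv; apply: jacobson_sqr.
have -> : 3%:R * (u - 1) * (3%:R * (u - 1)) =
  9%:R * (u * u - 1) + (3%:R * (1 - u)) * 6%:R by nc_ring.
apply: jacobsonD; apply: jacobsonMl; last exact: six_mod_jacobson.
exact: invertible_sqr_mod_jacobson.
Qed.

(** Modulo J, [e] is central, [u^2 = 1], [3 u = 3] and [6 = 0], so [(e + u)^3 = 7 e + u = e + u] and
    [3 ((e + u)^2 - (e + u)) = 6 e u + 3 - 3 u = 0]. *)
Lemma tripotent_mod_jacobson a :
  jacobson (a * a * a - a) /\ jacobson (3%:R * (a * a - a)).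
Proof.
have [e [u [ee uinv ->]]] := cleanR a.
have J6 := six_mod_jacobson.
have Juu := invertible_sqr_mod_jacobson uinv.
have J3 := invertible_sub1_mul3_jacobson uinv.
have Jc : jacobson (e * u - u * e) by apply: idempotent_central_mod_jacobson.
have eel z : z * e * e = z * e by rewrite -mulrA ee.
split.
  have -> : (e + u) * (e + u) * (e + u) - (e + u) = e * 6%:R
    + e * (3%:R * (u - 1)) - 2%:R * (e * (e * u - u * e))
    + 2%:R * (e * (u * u - 1)) + (u * u - 1 - (e * u - u * e)) * (e + u).
    have -> : e * 6%:R = 6%:R * e by nc_ring.
    have -> : e * (3%:R * (u - 1)) = 3%:R * (e * (u - 1)) by nc_ring.
    by rewrite !mulr_natl !expandE; do !rewrite ?(ee, eel); nc_ring.
  by apply: jacobsonD; auto 8 using jacobsonD, jacobsonB, jacobsonMl, jacobsonMr.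
have -> : 3%:R * ((e + u) * (e + u) - (e + u)) = e * u * 6%:R
    - 3%:R * (e * u - u * e) + 3%:R * (u * u - 1) - 3%:R * (u - 1)
    + 3%:R * (e * e - e) by nc_ring.
rewrite ee subrr mulr0 addr0.
by auto 8 using jacobsonD, jacobsonB, jacobsonMl.
Qed.

End TwoUQ.

(** * Orthogonal lifting and the tripotent lift *)

Lemma orthogonal_lift_idempotent (R : pzRingType) (f g : R) :
  idempotent_elt f -> idempotent_elt g -> jacobson (f * g) -> jacobson (g * f) ->
  exists h, [/\ idempotent_elt h, f * h = 0, h * f = 0 & jacobson (g - h)].
Proof.
move=> ff gg Jfg Jgf; have [v [uv vu]] := invertible1B_jacobson Jgf.
set u := 1 - g * f in uv vu.
(* Conjugation by [u], which is 1 modulo J, gives [k * f = 0] because [g * u * f = g * f - g * f];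
   the factor [1 - f] then gives orthogonality on the other side. *)
pose k := v * g * u.
have kk : k * k = k.
  have -> : k * k = v * g * (u * v) * g * u by rewrite /k; nc_ring.
  by rewrite uv mulr1 -(mulrA v) gg.
have kf : k * f = 0.
  have -> : k * f = v * (g * f - g * g * (f * f)) by rewrite /k /u; nc_ring.
  by rewrite ff gg subrr mulr0.
exists ((1 - f) * k); split.
- rewrite /idempotent_elt.
  have -> : (1 - f) * k * ((1 - f) * k) = (1 - f) * (k * k - k * f * k) by nc_ring.
  by rewrite kk kf mul0r subr0.
- have -> : f * ((1 - f) * k) = (f - f * f) * k by nc_ring.
  by rewrite ff subrr mul0r.
- by rewrite -mulrA kf mulr0.
- have vE : v = 1 + v * (g * f) by rewrite -{1}vu /u; nc_ring.
  have -> : g - (1 - f) * k = v * (g * (g * f)) - v * (g * f) * g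
    + (1 - v * u) * g + f * g * u + f * (v * (g * f) * g * u)
    - f * (1 + v * (g * f) - v) * g * u by rewrite /k /u; nc_ring.
  rewrite -vE vu !subrr !(mulr0, mul0r) addr0 subr0.
  by auto 10 using jacobsonD, jacobsonB, jacobsonMl, jacobsonMr.
Qed.

Lemma clean_two_UQ_semi_tripotent (R : pzRingType) :
  two_UQ R -> clean R -> semi_tripotent R.
Proof.
move=> UQ cleanR a.
have [Ja Jd] := tripotent_mod_jacobson UQ cleanR a.
(* Since [6 = 0] modulo J, [R/J] splits into a part with [2 = 0], where [f0 = a] and [g0 = 0], and
   one with [3 = 0], where [f0] and [g0] indicate the values 1 and -1 of [a]. *)
pose f0 := 2%:R * a - a * a; pose g0 := a - a * a.
have [|f ff Jf] := @clean_lift_idempotent _ cleanR f0.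
  have -> : f0 * f0 - f0 = 2%:R * (3%:R * (a * a - a))
    + (a - 4%:R) * (a * a * a - a) by rewrite /f0; nc_ring.
  by apply: jacobsonD; apply: jacobsonMl.
have [|g gg Jg] := @clean_lift_idempotent _ cleanR g0.
  have -> : g0 * g0 - g0 = 3%:R * (a * a - a)
    + (a - 2%:R) * (a * a * a - a) by rewrite /g0; nc_ring.
  by apply: jacobsonD => //; apply: jacobsonMl.
have Jfg0 : jacobson (f0 * g0).
  have -> : f0 * g0 = 3%:R * (a * a - a)
    + (a - 3%:R) * (a * a * a - a) by rewrite /f0 /g0; nc_ring.
  by apply: jacobsonD => //; apply: jacobsonMl.
have Jgf0 : jacobson (g0 * f0).
  by rewrite (_ : g0 * f0 = f0 * g0) // /f0 /g0; nc_ring.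
have Jfg : jacobson (f * g).
  have -> : f * g = f0 * g0 - (f0 - f) * g0 - f * (g0 - g) by nc_ring.
  by auto 8 using jacobsonB, jacobsonMl, jacobsonMr.
have Jgf : jacobson (g * f).
  have -> : g * f = g0 * f0 - (g0 - g) * f0 - g * (f0 - f) by nc_ring.
  by auto 8 using jacobsonB, jacobsonMl, jacobsonMr.
have [h [hh fh hf Jh]] := orthogonal_lift_idempotent ff gg Jfg Jgf.
exists (f - h), ((f0 - f) - (g0 - g) - (g - h)); split.
- rewrite /tripotent_elt.
  have -> : (f - h) ^+ 3 = f * f * f - h * h * h - (f * h) * (f - h)
    - (h * f) * (f - h) + (h * h) * f - (f * f) * h by nc_ring.
  by rewrite !(ff, hh, fh, hf); nc_ring.
- by auto using jacobsonB.
- by rewrite /f0 /g0; nc_ring.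
Qed.

(** * The converse implication *)

Lemma semi_tripotent_clean (R : pzRingType) : semi_tripotent R -> clean R.
Proof.
move=> st a; have [e [j [e3 Jj ->]]] := st a.
move: e3; rewrite /tripotent_elt !exprS expr0 mulr1 => e3.
exists (1 - e * e), (e * e + e - 1 + j); split; last by nc_ring.
  rewrite /idempotent_elt.
  have -> : (1 - e * e) * (1 - e * e) =
    1 - e * e + (e * (e * e) - e) * e by nc_ring.
  by rewrite e3 subrr mul0r addr0.
have vv : (e * e + e - 1) * (e * e + e - 1) = 1.
  have -> : (e * e + e - 1) * (e * e + e - 1) =
    1 + (e * (e * e) - e) * e + 2%:R * (e * (e * e) - e) by nc_ring.
  by rewrite e3 subrr mul0r mulr0 !addr0.
(* The involution [v] inverts [v + j] modulo J. *)
move: (_ + e - 1) vv => v vv; apply: (@invertible_mod_jacobson _ _ v).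
  by rewrite mulrDl vv addrC addKr; exact: jacobsonMr.
by rewrite mulrDr vv addrC addKr; exact: jacobsonMl.
Qed.

Lemma semi_tripotent_two_UQ (R : pzRingType) : semi_tripotent R -> two_UQ R.
Proof.
move=> st u [s [us su]]; have [e [j [e3 Jj uE]]] := st u.
have [t [et te]] : invertible e.
  have eE : e = u - j by rewrite uE; nc_ring.
  apply: (@invertible_mod_jacobson _ e s); rewrite eE.
    by rewrite mulrBl us addrAC subrr sub0r; auto using jacobsonN, jacobsonMr.
  by rewrite mulrBr su addrAC subrr sub0r; auto using jacobsonN, jacobsonMl.
have ee : e * e = 1.
  have -> : e * e = t * e ^+ 3 by rewrite !exprS expr0 mulr1 mulrA te mul1r.
  by rewrite e3.
(* As [e * e = 1], the idempotent part is 1 and the rest of [(e + j)^2] lies in J. *)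
exists 1, (e * j + j * e + j * j); split.
- exact: mulr1.
- by apply: jacobson_quasi_nilpotent; auto using jacobsonD, jacobsonMl, jacobsonMr.
- by rewrite mul1r mulr1.
- by rewrite uE -ee; nc_ring.
Qed.

Theorem corollary3p6 (R : pzRingType) :
  (two_UQ R /\ clean R) <-> semi_tripotent R.
Proof.
split=> [[UQ cleanR]|st]; first exact: clean_two_UQ_semi_tripotent.
by split; [exact: semi_tripotent_two_UQ|exact: semi_tripotent_clean].
Qed.
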